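(* Let $\mathsf{Cat}_1$ be a nice metric-algebraic category with $\mathsf{Banach}\subseteq \mathsf{Cat}_1$. Let $X$ be a real Banach space, $Y\subseteq X$ a closed subspace, $\lambda\ge 1$, and let $j\colon Y\to Y^{**}$ be the canonical embedding. The following are equivalent: (1) For every dual Banach space $Z^*$ and every $\mathsf{Cat}_1$-morphism $f\colon Y\to Z^*$ there exists a $\mathsf{Cat}_1$-morphism $h\colon X\to Z^*$ with $h|_Y=f$ and $\|h\|\le \lambda\|f\|$. (2) There is a $\mathsf{Cat}_1$-morphism $h\colon X\to Y^{**}$ with $\|h\|\le\lambda$ and $h|_Y=j$. (3) For every $\varepsilon>0$ and every finite set $G\subseteq X$ there exist a subset $V$ with $G\subseteq V\subseteq X$ which is an object of $\mathsf{Cat}_1$ with the metric and operations inherited from $X$, and a $\mathsf{Cat}_1$-morphism $\varphi\colon V\to Y$ with $\|\varphi\|\le\lambda(1+\varepsilon)$ and $\varphi(e)=e$ for every $e\in V\cap Y$. (4) For every $\varepsilon>0$ and every finite set $G\subseteq X$ there exist a subset $V$ with $G\subseteq V\subseteq X$ which is an object of $\mathsf{Cat}_1$ with the metric and operations inherited from $X$, and a $\mathsf{Cat}_1$-morphism $\varphi\colon V\to Y$ with $\|\varphi\|\le\lambda(1+\varepsilon)$ and $\|\varphi(e)-e\|<\varepsilon$ for every $e\in V\cap Y$.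
   Context: A metric-algebraic category is specified by an index set $I$, arities $n_i\in\{0,1,2,\dots\}$ ($i\in I$) and a set of axioms; its objects are tuples $(X,d,\{\sigma_i\}_{i\in I})$ with $d$ a metric on $X$ and $\sigma_i\colon X^{n_i}\to X$ operations satisfying the axioms, and its morphisms $T\colon (X,d,\{\sigma_i\})\to(Y,d',\{\tau_i\})$ are the maps that are Lipschitz, with norm $\|T\|=\sup\{d'(Tx,Ty)/d(x,y): x\neq y\}<\infty$, and satisfy $T(\sigma_i(x_1,\dots,x_{n_i}))=\tau_i(Tx_1,\dots,Tx_{n_i})$ for all $i$ and all $x_1,\dots,x_{n_i}$. For two such categories, $\mathsf{Cat}_2\subseteq\mathsf{Cat}_1$ means that the list of operations and axioms defining $\mathsf{Cat}_2$ contains the list defining $\mathsf{Cat}_1$; thus every $\mathsf{Cat}_2$-object is a $\mathsf{Cat}_1$-object (forgetting operations) and every $\mathsf{Cat}_2$-morphism is a $\mathsf{Cat}_1$-morphism. $\mathsf{Banach}$ is the metric-algebraic category of real Banach spaces, with metric induced by the norm and with operations the linear combinations $(x_1,\dots,x_n)\mapsto r_1x_1+\dots+r_nx_n$ ($r_k\in\mathbb R$), whose morphisms are exactly the bounded linear operators. Thus when $\mathsf{Banach}\subseteq\mathsf{Cat}_1$, every Banach space is a $\mathsf{Cat}_1$-object, every bounded operator is a $\mathsf{Cat}_1$-morphism, and every operation of $\mathsf{Cat}_1$ is some linear combination (for example $\mathsf{Cat}_1=\mathsf{Metric}$, pointed metric spaces with Lipschitz maps preserving the base point $0$). A metric-algebraic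 category $\mathsf{Cat}_1$ is nice if whenever $f\colon A\to B$ is a $\mathsf{Cat}_1$-morphism and $D\subseteq B$ is a $\mathsf{Cat}_1$-object with the operations inherited from $B$, then $f^{-1}(D)$ is a $\mathsf{Cat}_1$-object with the operations inherited from $A$. *)

(* Defs.v *)
From HB Require Import structures.
From mathcomp Require Import all_boot all_order all_algebra.
From mathcomp Require Import all_classical all_reals all_analysis.
From mathcomp Require Import Rstruct Rstruct_topology.
Unset Printing Implicit Defensive.
Import Order.TTheory GRing.Theory Num.Theory.
Import numFieldNormedType.Exports.
Local Open Scope classical_set_scope.
Local Open Scope ring_scope.

Notation RR := Rdefinitions.R.

(* Since Banach ⊆ Cat_1, every operation of Cat_1 is a linear          *)
(* combination: operation i has arity [ar i] and is                    *)
(*   (x_1,...,x_n) |-> sum_k coef i k * x_k   on Banach spaces.         *)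
Record cat_sig := CatSig {
  cidx : Type;
  car : cidx -> nat;
  ccoef : forall i, 'I_(car i) -> RR;
  cax : forall T : Type, (T -> T -> RR) -> (forall i, ('I_(car i) -> T) -> T) -> Prop
}.

Definition ops_of (C : cat_sig) (T : Type) := forall i : cidx C, ('I_(car C i) -> T) -> T.

Definition is_metric (T : Type) (d : T -> T -> RR) :=
  [/\ forall x y, 0 <= d x y,
      forall x y, d x y = 0 <-> x = y,
      forall x y, d x y = d y x
    & forall x y z, d x z <= d x y + d y z].

Definition is_obj (C : cat_sig) (T : Type) (d : T -> T -> RR) (s : ops_of C T) :=
  is_metric T d /\ cax C T d s.

Definition is_morph (C : cat_sig) (T1 : Type) (d1 : T1 -> T1 -> RR) (s1 : ops_of C T1)
  (T2 : Type) (d2 : T2 -> T2 -> RR) (s2 : ops_of C T2) (f : T1 -> T2) :=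
  (exists L : RR, forall x y, d2 (f x) (f y) <= L * d1 x y) /\
  (forall i (v : 'I_(car C i) -> T1), f (s1 i v) = s2 i (f \o v)).

Definition closed_under (C : cat_sig) (T : Type) (s : ops_of C T) (D : set T) :=
  forall i (v : 'I_(car C i) -> T), (forall k, D (v k)) -> D (s i v).

Definition sub_ops (C : cat_sig) (T : Type) (s : ops_of C T) (D : set T)
  (cl : closed_under C T s D) : ops_of C {x : T | D x} :=
  fun i v => exist D (s i (fun k => sval (v k))) (cl i _ (fun k => proj2_sig (v k))).

Definition is_subobj (C : cat_sig) (T : Type) (d : T -> T -> RR) (s : ops_of C T)
  (D : set T) :=
  exists cl : closed_under C T s D,
    is_obj C {x : T | D x} (fun x y => d (sval x) (sval y)) (sub_ops C T s D cl).

Definition nice (C : cat_sig) :=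
  forall (TA : Type) (dA : TA -> TA -> RR) (sA : ops_of C TA)
         (TB : Type) (dB : TB -> TB -> RR) (sB : ops_of C TB)
         (f : TA -> TB) (D : set TB),
    is_obj C TA dA sA -> is_obj C TB dB sB -> is_morph C TA dA sA TB dB sB f ->
    is_subobj C TB dB sB D -> is_subobj C TA dA sA (f @^-1` D).

Definition bdist (E : normedModType RR) : E -> E -> RR := fun x y => `|x - y|.

Definition bops (C : cat_sig) (E : normedModType RR) : ops_of C E :=
  fun i v => \sum_(k < car C i) ccoef C i k *: v k.

Definition banach_in (C : cat_sig) :=
  forall E : completeNormedModType RR, is_obj C E (bdist E) (bops C E).

Definition bmorph (C : cat_sig) (E F : normedModType RR) (D : set E) (S : set F)
  (f : E -> F) :=
  [/\ forall x, D x -> S (f x),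
      exists L : RR, forall x y, D x -> D y -> `|f x - f y| <= L * `|x - y|
    & forall i (v : 'I_(car C i) -> E), (forall k, D (v k)) ->
        f (bops C E i v) = bops C F i (f \o v)].

Definition lipnorm (E F : normedModType RR) (D : set E) (f : E -> F) : RR :=
  sup [set r | exists x y, [/\ D x, D y, x <> y & r = `|f x - f y| / `|x - y|]].

Definition closed_subspace (E : normedModType RR) (Y : set E) :=
  [/\ closed Y, Y 0 & forall (a : RR) y1 y2, Y y1 -> Y y2 -> Y (a *: y1 + y2)].

(* Dual spaces.  [dual_rep_on S iota] says that the Banach space E,     *)
(* via iota, is (isometrically, linearly) the dual S^* of the subspace  *)
(* S of Z: each iota e restricted to S is a continuous linear           *)
(* functional on S, iota is linear, every continuous linear functional *)
(* on S is of this form, and |e| is the dual norm of iota e.           *)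
(* With S = setT this says E is (a copy of) the dual Z^*.              *)
Definition lin_on (Z : normedModType RR) (S : set Z) (g : Z -> RR) :=
  forall (a : RR) z1 z2, S z1 -> S z2 -> g (a *: z1 + z2) = a * g z1 + g z2.

Definition dual_rep_on (Z E : normedModType RR) (S : set Z) (iota : E -> Z -> RR) :=
  [/\ forall e, lin_on Z S (iota e),
      forall e, {within S, continuous (iota e)},
      forall (a : RR) e1 e2 z, S z -> iota (a *: e1 + e2) z = a * iota e1 z + iota e2 z,
      forall g : Z -> RR, lin_on Z S g -> {within S, continuous g} ->
        exists e, forall z, S z -> iota e z = g z
    & forall e, `|e| = sup [set r | exists z, [/\ S z, `|z| <= 1 & r = `|iota e z|]]].

(* Main.v *)
Require Import Defs.
From HB Require Import structures.
From mathcomp Require Import all_boot all_order all_algebra.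
From mathcomp Require Import all_classical all_reals all_analysis.
From mathcomp Require Import Rstruct Rstruct_topology.
From mathcomp Require Import ring lra.
Import Order.TTheory GRing.Theory Num.Theory.
Import numFieldNormedType.Exports.
Local Open Scope classical_set_scope.
Local Open Scope ring_scope.

(* (1) => (2): extend the canonical embedding j.
   (2) => (3): local reflexivity.  For a finite-dimensional D containing h(G)
   there is a linear T : D -> Y of norm at most 1 + eps with T (j y) = y when
   j y lies in D; niceness makes V = h^-1(D) an object, and phi = T o h.  The
   operator T is found by solving finitely many norm constraints on the images
   of a basis of D; were they unsolvable, a functional on a finite power of X
   separating the constraints from the admissible values would contradict the
   fact that D itself sits in the dual of Y^*.
   (4) => (1): index the maps f o phi by the pairs (G, eps) and take their
   pointwise weak-star limit along an ultrafilter. *)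

(** * Closed subspaces as Banach spaces *)

(** The morphisms in the four conditions need not be linear, so all linear work happens on the
    target side: [T] is linear on a finite-dimensional subspace of the bidual, while the domain [V]
    is reached only through niceness. That [T] must fix the whole part of [j Y] lying in [D],
    although only its values on a basis can be prescribed; this calls for a basis of [D] containing
    a basis of that part. A bound on the norm of [T] is a constraint for every point of a sphere, so
    the slack [eps] is shared between solving finitely many constraints and passing from a net to
    the sphere. Functionals on [Y] are stored as functions on [X], hence one found on a power of [X]
    is simply restricted. In the limit argument the factor [1 + eps] and the error [eps] disappear
    because the filter makes [eps] eventually small, and operations survive because they are linear
    combinations. *)

(* The axioms of [C] need not be invariant under isomorphism, so the carrier has
   to be literally the sigma type appearing in [is_subobj]. *)
Section ClosedSubspace.
Context {E : completeNormedModType RR} {D : set E} (hD : closed_subspace E D).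

Let D0 : D 0. Proof. by case: hD. Qed.
Let Dlin a x y : D x -> D y -> D (a *: x + y).
Proof. by case: hD => _ _; apply. Qed.

(** The proof is kept as an index of the type, so that the structures declared below can be inferred
    from it. *)
Definition subspace_type of closed_subspace E D : Type := {x : E | D x}.
Local Notation S := (subspace_type hD).

HB.instance Definition _ := gen_eqMixin S.
HB.instance Definition _ := gen_choiceMixin S.

Let sv : S -> E := fun u => sval u.
Let svI : injective sv. Proof. by move=> u v; apply: eq_sig_hprop => *; apply: Prop_irrelevance. Qed.
Let szero : S := exist D 0 D0.
(** The trailing [+ 0] makes membership a literal instance of the single closure property [Dlin]. *)
Let sscale (a : RR) (u : S) : S := exist D (a *: sv u + 0) (Dlin a _ _ (proj2_sig u) D0).
Let sadd (u v : S) : S :=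
  exist D (1 *: sv u + sv v) (Dlin 1 _ _ (proj2_sig u) (proj2_sig v)).
Let sopp (u : S) : S := sscale (-1) u.

Let saddE u v : sv (sadd u v) = sv u + sv v.
Proof. by rewrite /sadd /sv /= scale1r. Qed.
Let sscaleE a u : sv (sscale a u) = a *: sv u.
Proof. by rewrite /sscale /sv /= addr0. Qed.
Let soppE u : sv (sopp u) = - sv u.
Proof. by rewrite sscaleE scaleN1r. Qed.
Let saddA : associative sadd.
Proof. by move=> u v w; apply: svI; rewrite !saddE addrA. Qed.
Let saddC : commutative sadd.
Proof. by move=> u v; apply: svI; rewrite !saddE addrC. Qed.
Let sadd0 : left_id szero sadd.
Proof. by move=> u; apply: svI; rewrite !saddE add0r. Qed.
Let saddN : left_inverse szero sopp sadd.
Proof. by move=> u; apply: svI; rewrite !saddE soppE addNr. Qed.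

HB.instance Definition _ := GRing.isZmodule.Build S saddA saddC sadd0 saddN.

Let sscaleA a b (v : S) : sscale a (sscale b v) = sscale (a * b) v.
Proof. by apply: svI; rewrite !sscaleE scalerA. Qed.
Let sscale1 : left_id 1 sscale.
Proof. by move=> v; apply: svI; rewrite sscaleE scale1r. Qed.
Let sscaleDr : right_distributive sscale +%R.
Proof. by move=> a u v; apply: svI; rewrite sscaleE !saddE !sscaleE scalerDr. Qed.
Let sscaleDl v : {morph sscale^~ v : a b / a + b}.
Proof. by move=> a b; apply: svI; rewrite saddE !sscaleE scalerDl. Qed.

HB.instance Definition _ :=
  GRing.Zmodule_isLmodule.Build RR S sscaleA sscale1 sscaleDr sscaleDl.

Let snorm (u : S) : RR := `|sv u|.
Let snormD u v : snorm (u + v) <= snorm u + snorm v.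
Proof. by rewrite /snorm saddE ler_normD. Qed.
Let snormZ a u : snorm (a *: u) = `|a| * snorm u.
Proof. by rewrite /snorm sscaleE normrZ. Qed.
Let snorm0 u : snorm u = 0 -> u = 0.
Proof. by move=> /normr0_eq0 u0; apply: svI; rewrite u0. Qed.

HB.instance Definition _ := Lmodule_isNormed.Build RR S snormD snormZ snorm0.

Let subspace_complete (F : set_system S) : ProperFilter F -> cauchy F -> cvg F.
Proof.
move=> FF /cauchyP Fc.
have sE (u v : S) : `|u - v| = `|sv u - sv v|.
  by rewrite -soppE -saddE.
have : cvg (sv @ F).
  apply: cauchy_cvg; apply/cauchy_exP => e e0; have [u uF] := Fc e e0.
  exists (sv u); rewrite /nbhs /=; apply: filterS uF => v.
  by rewrite -!ball_normE /= sE.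
move=> /cvg_ex[l Fl].
have Dl : D l.
  apply: (closed_cvg D _ _ _ Fl); first by case: hD.
  by apply: filterE => u; exact: proj2_sig u.
apply/cvg_ex; exists (exist D l Dl : S).
apply/cvgrPdist_lt => e e0; move/cvgrPdist_lt: Fl => /(_ e e0).
by apply: filterS => u; rewrite sE.
Qed.

HB.instance Definition _ := Uniform_isComplete.Build S subspace_complete.
End ClosedSubspace.

(** A closed subspace is a Banach space in its own right, so [hban] supplies the axioms for it. They
    transfer because its metric and operations are equal, as functions, to the inherited ones. *)
Lemma closed_subspace_subobj (C : cat_sig) (hban : banach_in C)
    (E : completeNormedModType RR) (D : set E) :
  closed_subspace E D -> is_subobj C E (bdist E) (bops C E) D.
Proof.
move=> hD; have [_ D0 Dlin] := hD.
have cl : closed_under C E (bops C E) D.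
  move=> i v Dv; rewrite /bops; elim/big_ind: _ => //.
    by move=> x y Dx Dy; rewrite -[x]scale1r; apply: Dlin.
  by move=> k _; rewrite -[_ *: _]addr0; apply: Dlin.
exists cl; have := hban (subspace_type hD).
suff [-> ->] : bdist (subspace_type hD) = (fun x y => bdist E (sval x) (sval y)) /\
    bops C (subspace_type hD) = sub_ops C E (bops C E) D cl by [].
split.
  apply/funext => x; apply/funext => y; rewrite /bdist /=.
  by rewrite /Num.norm /= scale1r addr0 scaleN1r.
apply/functional_extensionality_dep => i; apply/funext => v.
apply: eq_sig_hprop => [? ? ?|]; first exact: Prop_irrelevance.
rewrite /= /bops.
have sD : {morph (fun u : subspace_type hD => sval u) : x y / x + y}.
  by move=> x y; rewrite /= scale1r.
rewrite (big_morph _ sD (erefl _)); apply: eq_bigr => k _.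
by rewrite /= addr0.
Qed.

(** * Hahn-Banach *)

Definition sublinear (V : lmodType RR) (p : V -> RR) :=
  (forall x y, p (x + y) <= p x + p y) /\
  (forall t x, 0 <= t -> p (t *: x) = t * p x).

Lemma sublinear_opp (V : lmodType RR) (p : V -> RR) x : sublinear V p -> - p (- x) <= p x.
Proof.
move=> [pD pZ]; have := pD x (- x).
rewrite subrr -[0](scale0r (0 : V)) pZ// mul0r; lra.
Qed.

(** For sublinear [p] this is the largest sublinear functional below [p] whose value at [- y] is at
    most [- p y]. *)
Definition slide (V : lmodType RR) (p : V -> RR) (y x : V) : RR :=
  inf [set r | exists2 t, 0 <= t & r = p (x + t *: y) - t * p y].

Lemma slide_lb (V : lmodType RR) (p : V -> RR) (y x : V) : sublinear V p ->
  lbound [set r | exists2 t, 0 <= t & r = p (x + t *: y) - t * p y] (- p (- x)).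
Proof.
move=> [pD pZ] _ [t t0 ->]; have := pD (x + t *: y) (- x).
by rewrite [x + _]addrC addrK pZ//; lra.
Qed.

Lemma slide_le (V : lmodType RR) (p : V -> RR) (y x : V) t : sublinear V p ->
  0 <= t -> slide V p y x <= p (x + t *: y) - t * p y.
Proof.
move=> sp t0; apply: ge_inf; last by exists t.
by exists (- p (- x)); exact: slide_lb.
Qed.

Lemma slide_ge (V : lmodType RR) (p : V -> RR) (y x : V) c :
  (forall t, 0 <= t -> c <= p (x + t *: y) - t * p y) -> c <= slide V p y x.
Proof.
move=> h; apply: lb_le_inf; last by move=> _ [t t0 ->]; exact: h.
by exists (p (x + 0 *: y) - 0 * p y), 0.
Qed.

Lemma slide_sublinear (V : lmodType RR) (p : V -> RR) y :
  sublinear V p -> sublinear V (slide V p y).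
Proof.
move=> sp; have [pD pZ] := sp.
have p0 : p 0 = 0 by rewrite -[0](scale0r (0 : V)) pZ// mul0r.
split=> [x x'|t x].
  suff: slide V p y (x + x') - slide V p y x <= slide V p y x' by lra.
  apply: slide_ge => t t0.
  suff: slide V p y (x + x') - (p (x' + t *: y) - t * p y) <= slide V p y x by lra.
  apply: slide_ge => t' t'0.
  (* The parameters of the two infima add up to an admissible parameter for [x + x']. *)
  have := slide_le V p y (x + x') (t' + t) sp (addr_ge0 t'0 t0).
  have := pD (x + t' *: y) (x' + t *: y).
  rewrite addrACA -scalerDl; lra.
rewrite le_eqVlt => /predU1P[<-|t0].
  rewrite scale0r mul0r; apply/eqP; rewrite eq_le; apply/andP; split.
    by have := slide_le V p y 0 0 sp (lexx _); rewrite scale0r addr0 p0; lra.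
  by apply: slide_ge => s s0; rewrite add0r pZ//; lra.
(* One inequality for all positive scalars is enough: used with [t^-1] it gives the reverse one. *)
have key (s : RR) z : 0 < s -> slide V p y (s *: z) <= s * slide V p y z.
  move=> s0; rewrite -ler_pdivrMl//; apply: slide_ge => r r0.
  rewrite ler_pdivrMl//.
  have sr : 0 <= s * r by rewrite mulr_ge0// ltW.
  have := slide_le V p y (s *: z) (s * r) sp sr.
  rewrite -scalerA -scalerDr (pZ _ _ (ltW s0)); lra.
apply/eqP; rewrite eq_le key//=.
have ti : 0 < t^-1 by rewrite invr_gt0.
have := key t^-1 (t *: x) ti.
by rewrite scalerA mulVf ?gt_eqF// scale1r -ler_pdivrMl ?invr_gt0// invrK.
Qed.

(* A minimal sublinear functional below [q] equals each of its slides, which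
   forces additivity; sliding towards [b] first makes the value at [b] exact. *)
Theorem hahn_banach (V : lmodType RR) (q : V -> RR) (b : V) : sublinear V q ->
  exists L : V -> RR, [/\ forall a x y, L (a *: x + y) = a * L x + L y,
    forall x, L x <= q x & L b = q b].
Proof.
move=> sq.
pose q' := slide V q b.
have sq' : sublinear V q' by exact: slide_sublinear.
have [qD qZ] := sq.
have q0 : q 0 = 0 by rewrite -[0](scale0r (0 : V)) qZ// mul0r.
pose T := {p : V -> RR | sublinear V p /\ forall x, p x <= q' x}.
(* The order is reversed, so that a maximal element for [R] is a minimal functional. *)
pose R (p p' : T) := `[< forall x, sval p' x <= sval p x >].
have [| | | |[p [sp pq']] pmin] := @Zorn T R.
- by move=> t; apply/asboolP.
- by move=> r s t /asboolP rs /asboolP st; apply/asboolP => x; exact: le_trans (rs x).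
- move=> [s hs] [t ht] /asboolP st /asboolP ts; apply: eq_exist.
  by apply/funext => x; apply/eqP; rewrite eq_le st ts.
(* A chain is bounded by its pointwise infimum, the empty chain by [q'] itself. *)
- move=> A totA; have [[p0 Ap0]|A0] := pselect (exists p, A p); last first.
    exists (exist _ q' (conj sq' (fun x => lexx _))) => s As.
    by exfalso; apply: A0; exists s.
  pose S x := [set r | exists2 p, A p & r = sval p x].
  have Slb x : lbound (S x) (- q' (- x)).
    move=> _ [[p [sp pq]] Ap ->] /=; have := sublinear_opp V p x sp.
    by have := pq (- x); lra.
  pose m x := inf (S x).
  have mle p x : A p -> m x <= sval p x.
    by move=> Ap; apply: ge_inf; [exists (- q' (- x)) => // | exists p].
  have mge x c : (forall p, A p -> c <= sval p x) -> c <= m x.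
    move=> h; apply: lb_le_inf; first by exists (sval p0 x), p0.
    by move=> _ [p Ap ->]; exact: h.
  have sm : sublinear V m.
    split=> [x y|t x].
      suff: m (x + y) - m x <= m y by lra.
      apply: (mge) => p Ap.
      suff: m (x + y) - sval p y <= m x by lra.
      apply: (mge) => p' Ap'.
      have [/asboolP pp'|/asboolP pp'] := totA p p' Ap Ap'.
        have := mle p' (x + y) Ap'; have := (proj2_sig p').1.1 x y.
        by have := pp' y; lra.
      have := mle p (x + y) Ap; have := (proj2_sig p).1.1 x y.
      by have := pp' x; lra.
    rewrite le_eqVlt => /predU1P[<-|t0].
      rewrite scale0r mul0r.
      have z p : A p -> sval p 0 = 0.
        by move=> Ap; rewrite -[0](scale0r (0 : V)) (proj2_sig p).1.2// mul0r.
      apply/eqP; rewrite eq_le; apply/andP; split.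
        by rewrite -(z _ Ap0); exact: (mle).
      by apply: (mge) => p Ap; rewrite z.
    apply/eqP; rewrite eq_le; apply/andP; split.
      rewrite -ler_pdivrMl//; apply: (mge) => p Ap; rewrite ler_pdivrMl//.
      by rewrite -((proj2_sig p).1.2 _ _ (ltW t0)); exact: (mle).
    apply: (mge) => p Ap; rewrite ((proj2_sig p).1.2 _ _ (ltW t0)) ler_pM2l//; exact: (mle).
  have mq x : m x <= q' x.
    by apply: le_trans (mle _ x Ap0) _; exact: (proj2_sig p0).2.
  exists (exist _ m (conj sm mq)) => p Ap; apply/asboolP => x /=; exact: (mle).
have slp y x : slide V p y x = p x.
  have sle x' : slide V p y x' <= p x'.
    by have := slide_le V p y x' 0 sp (lexx _); rewrite scale0r addr0; lra.
  have H : sublinear V (slide V p y) /\ forall x, slide V p y x <= q' x.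
    by split; [exact: slide_sublinear | move=> x'; exact: le_trans (sle x') (pq' x')].
  have e : exist _ _ H = exist _ p (conj sp pq') :> T.
    by apply: pmin; apply/asboolP.
  by have /= -> := congr1 sval e.
have [pD pZ] := sp.
have pA x y : p (x + y) = p x + p y.
  apply/eqP; rewrite eq_le pD/=.
  have := slide_le V p y x 1 sp ler01; rewrite slp scale1r mul1r; lra.
have pN x : p (- x) = - p x.
  have := pA x (- x); rewrite subrr -[X in p X = _](scale0r (0 : V)) pZ// mul0r; lra.
have pS a x : p (a *: x) = a * p x.
  have [a0|/ltW a0] := leP 0 a; first exact: pZ.
  rewrite -[a]opprK scaleNr pN pZ ?oppr_ge0//; lra.
have pq x : p x <= q x.
  apply: le_trans (pq' x) _.
  have := slide_le V q b x 0 sq (lexx _); rewrite scale0r addr0 /q'; lra.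
exists p; split=> // [a x y|]; first by rewrite pA pS.
apply/eqP; rewrite eq_le pq/=.
(* At [- b] with parameter 1 the slide is at most [- q b]; since [p] is odd this bounds [p b] from
   below. *)
have := slide_le V q b (- b) 1 sq ler01; have := pq' (- b); rewrite /q' pN.
rewrite scale1r addNr q0; lra.
Qed.

(** The quotient seminorm [q], the [N]-distance to [M], is sublinear, vanishes on [M] and is at
    least 1 at [b]. Hahn-Banach below [q], exact at [b], gives [L]. Taking [N] to be a bare seminorm
    allows any scaled or weighted norm later. *)
Lemma dual_distance (V : lmodType RR) (N : V -> RR) (M : set V) (b : V) :
  (forall x, 0 <= N x) -> (forall x y, N (x + y) <= N x + N y) ->
  (forall t x, N (t *: x) = `|t| * N x) ->
  M 0 -> (forall a x y, M x -> M y -> M (a *: x + y)) ->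
  (forall m, M m -> 1 <= N (b + m)) ->
  exists L : V -> RR, [/\ forall a x y, L (a *: x + y) = a * L x + L y,
    forall x, L x <= N x, forall m, M m -> L m = 0 & 1 <= L b].
Proof.
move=> N0 ND NZ M0 Mlin Nb.
pose S x := [set r | exists2 m, M m & r = N (x + m)].
pose q x := inf (S x).
have qle x m : M m -> q x <= N (x + m).
  by move=> Mm; apply: ge_inf; [exists 0 => _ [m' _ ->] | exists m].
have qge x c : (forall m, M m -> c <= N (x + m)) -> c <= q x.
  move=> h; apply: lb_le_inf; first by exists (N (x + 0)), 0.
  by move=> _ [m Mm ->]; exact: h.
have MD x y : M x -> M y -> M (x + y).
  by move=> Mx My; rewrite -[x]scale1r; exact: Mlin.
have MZ t x : M x -> M (t *: x).
  by move=> Mx; rewrite -[_ *: _]addr0; exact: Mlin.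
have qm m : M m -> q m = 0.
  move=> Mm; apply/eqP; rewrite eq_le; apply/andP; split; last by apply: qge.
  have := qle m (- m); rewrite subrr -[X in N X](scale0r (0 : V)) NZ normr0 mul0r.
  by apply; rewrite -scaleN1r; exact: MZ.
have key t x : 0 < t -> q (t *: x) <= t * q x.
  move=> t0; rewrite -ler_pdivrMl//; apply: (qge) => m Mm; rewrite ler_pdivrMl//.
  by rewrite -{2}(gtr0_norm t0) -NZ scalerDr; apply: qle; exact: MZ.
have sq : sublinear V q.
  split=> [x y|t x].
    suff: q (x + y) - q x <= q y by lra.
    apply: (qge) => m Mm.
    suff: q (x + y) - N (y + m) <= q x by lra.
    apply: (qge) => m' Mm'.
    have := qle (x + y) (m' + m) (MD _ _ Mm' Mm).
    by have := ND (x + m') (y + m); rewrite addrACA; lra.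
  rewrite le_eqVlt => /predU1P[<-|t0]; first by rewrite scale0r mul0r qm.
  apply/eqP; rewrite eq_le key//=.
  have ti : 0 < t^-1 by rewrite invr_gt0.
  have := key t^-1 (t *: x) ti.
  by rewrite scalerA mulVf ?gt_eqF// scale1r -ler_pdivrMl ?invr_gt0// invrK.
have [L [Llin Lq Lb]] := hahn_banach V q b sq.
have L0 : L 0 = 0.
  have := Llin (-1) 0 0; rewrite scaleN1r addNr; lra.
exists L; split => //.
- by move=> x; apply: le_trans (Lq x) _; rewrite -{2}[x]addr0; exact: qle.
- move=> m Mm; apply/eqP; rewrite eq_le; apply/andP; split.
    by rewrite -(qm _ Mm).
  have := Lq (- m); rewrite -scaleN1r qm; last exact: MZ.
  by rewrite -[_ *: _]addr0 Llin L0; lra.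
- by rewrite Lb; exact: qge.
Qed.

(** * Concrete duals and Lipschitz norms *)

Definition subspace (V : lmodType RR) (S : set V) :=
  S 0 /\ forall (a : RR) x y, S x -> S y -> S (a *: x + y).

Lemma subspaceT (V : lmodType RR) : subspace V setT.
Proof. by []. Qed.

Lemma subspace_sum (V : lmodType RR) (S : set V) (I : Type) (r : seq I) (P : pred I)
    (a : I -> RR) (x : I -> V) : subspace V S ->
  (forall i, P i -> S (x i)) -> S (\sum_(i <- r | P i) a i *: x i).
Proof.
move=> [S0 Slin] Sx; elim: r => [|i r IH]; first by rewrite big_nil.
by rewrite big_cons; case: ifPn => // Pi; apply: Slin => //; exact: Sx.
Qed.

Lemma linear_on_sum (V V' : lmodType RR) (S : set V) (g : V -> V') (I : Type) (r : seq I)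
    (P : pred I) (a : I -> RR) (x : I -> V) : subspace V S ->
  (forall c u v, S u -> S v -> g (c *: u + v) = c *: g u + g v) ->
  (forall i, P i -> S (x i)) ->
  g (\sum_(i <- r | P i) a i *: x i) = \sum_(i <- r | P i) a i *: g (x i).
Proof.
move=> sS glin Sx; have [S0 Slin] := sS.
have g0 : g 0 = 0.
  have := glin (-1) 0 0 S0 S0; by rewrite !scaleN1r !addNr.
elim: r => [|i r IH]; first by rewrite !big_nil.
rewrite !big_cons; case: ifPn => // Pi.
by rewrite glin ?IH//; [exact: Sx | exact: subspace_sum].
Qed.

Lemma subspaceZ (V : lmodType RR) (S : set V) a x : subspace V S -> S x -> S (a *: x).
Proof. by move=> [S0 Sl] Sx; rewrite -[_ *: _]addr0; exact: Sl. Qed.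

Lemma lin_onZ (Z : normedModType RR) (S : set Z) (g : Z -> RR) a x :
  subspace Z S -> lin_on Z S g -> S x -> g (a *: x) = a * g x.
Proof.
move=> [S0 Sl] gl Sx; have g0 : g 0 = 0.
  have := gl (-1) 0 0 S0 S0; rewrite scaleN1r addNr; lra.
by rewrite -[a *: x]addr0 gl// g0 addr0.
Qed.

Lemma lipschitz_continuous (Z F : normedModType RR) (g : Z -> F) (L : RR) :
  (forall x y, `|g x - g y| <= L * `|x - y|) -> continuous g.
Proof.
move=> gL x; apply/cvgrPdist_lt => e e0.
have K0 : 0 < `|L| + 1 by rewrite ltr_pwDr.
near=> y; apply: (le_lt_trans (gL x y)).
apply: (@le_lt_trans _ _ ((`|L| + 1) * `|x - y|)).
  by rewrite ler_wpM2r//; have := ler_norm L; lra.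
rewrite -ltr_pdivlMl//; near: y.
by apply: cvgr_dist_lt => //; rewrite mulr_gt0// invr_gt0.
Unshelve. all: by end_near. Qed.

Section DualRep.
Context {Z E : normedModType RR} {S : set Z} {iota : E -> Z -> RR}.
Hypotheses (sS : subspace Z S) (hi : dual_rep_on Z E S iota).

Lemma dual_rep0 e : iota e 0 = 0.
Proof.
have [il _ _ _ _] := hi; have [S0 Sl] := sS.
by rewrite -[X in iota e X](scale0r (0 : Z)) (lin_onZ _ _ _ _ _ sS (il e)) ?mul0r.
Qed.

(** The norm of [e] is given by a real [sup], which carries information only for a bounded set.
    Continuity at 0 provides the bound. *)
Lemma dual_rep_bounded e : exists2 M : RR, 0 <= M & forall z, S z -> `|iota e z| <= M * `|z|.
Proof.
have [il ic _ _ _] := hi; have [S0 Sl] := sS.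
have /subspace_continuousP/(_ 0 S0) ice := ic e.
have i0 := dual_rep0 e.
have : iota e x @[x --> within S (nbhs 0)] --> (0 : RR) by rewrite -i0; exact: ice.
move=> /(_ _ (nbhsx_ballx (0 : RR) 1 ltr01))/nbhs_ballP[d /= d0 hd].
exists (2 / d); first by rewrite divr_ge0// ltW.
move=> z Sz; have [->|z0] := eqVneq z 0; first by rewrite i0 !normr0 mulr0.
have nz : 0 < `|z| by rewrite normr_gt0.
(* Half the radius puts [c *: z] strictly inside the ball. *)
pose c := d / 2 / `|z|.
have c0 : 0 < c by rewrite !divr_gt0.
have : `|0 - iota e (c *: z)| < 1.
  apply: hd; last by rewrite /=; exact: subspaceZ.
  rewrite -ball_normE /= sub0r normrN normrZ gtr0_norm// /c divfK ?gt_eqF//; lra.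
rewrite sub0r normrN (lin_onZ _ _ _ _ _ sS (il e) Sz) normrM gtr0_norm//.
rewrite mulrC -ltr_pdivlMr// => /ltW/le_trans; apply.
by rewrite mul1r /c !invfM !invrK [2 * _]mulrC mulrC.
Qed.

Lemma dual_rep_has_sup e :
  has_sup [set r | exists z, [/\ S z, `|z| <= 1 & r = `|iota e z|]].
Proof.
split; first by exists `|iota e 0|, 0; rewrite normr0; split=> //; case: sS.
have [M M0 h] := dual_rep_bounded e; exists M => _ [z [Sz z1 ->]].
by apply: le_trans (h z Sz) _; rewrite -[leRHS]mulr1 ler_wpM2l.
Qed.

Lemma dual_rep_bound e z : S z -> `|iota e z| <= `|e| * `|z|.
Proof.
have [il _ _ _ nE] := hi => Sz.
have i0 := dual_rep0 e.
have [->|z0] := eqVneq z 0; first by rewrite i0 !normr0 mulr0.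
have nz : 0 < `|z| by rewrite normr_gt0.
rewrite -ler_pdivrMr// nE; apply: sup_upper_bound; first exact: dual_rep_has_sup.
exists (`|z|^-1 *: z); split; first exact: subspaceZ.
  by rewrite normrZ gtr0_norm ?invr_gt0// mulVf ?gt_eqF.
by rewrite (lin_onZ _ _ _ _ _ sS (il e) Sz) normrM gtr0_norm ?invr_gt0// mulrC.
Qed.

Lemma dual_rep_norm_le e M : 0 <= M ->
  (forall z, S z -> `|iota e z| <= M * `|z|) -> `|e| <= M.
Proof.
have [_ _ _ _ nE] := hi => M0 h; rewrite nE; apply: ge_sup.
  by case: (dual_rep_has_sup e).
move=> _ [z [Sz z1 ->]]; apply: le_trans (h z Sz) _.
by rewrite -[leRHS]mulr1 ler_wpM2l.
Qed.

Lemma dual_repB e e' z : S z -> iota (e - e') z = iota e z - iota e' z.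
Proof.
have [_ _ ie _ _] := hi => Sz.
by have := ie (-1) e' e z Sz; rewrite scaleN1r mulN1r [- e' + e]addrC [- iota _ _ + _]addrC.
Qed.

Lemma dual_rep_inj e e' : (forall z, S z -> iota e z = iota e' z) -> e = e'.
Proof.
move=> h; apply/eqP; rewrite -subr_eq0 -normr_le0; apply: dual_rep_norm_le => // z Sz.
by rewrite dual_repB// h// subrr normr0 mul0r.
Qed.

Lemma dual_rep_lipschitz e e' M : 0 <= M ->
  (forall z, S z -> `|iota e z - iota e' z| <= M * `|z|) -> `|e - e'| <= M.
Proof. by move=> M0 h; apply: dual_rep_norm_le => // z Sz; rewrite dual_repB// h. Qed.

(** The supremum need not be attained, whence the factor [c]; replacing [z] by its opposite if
    necessary removes the absolute value. *)
Lemma dual_rep_norming e c : 1 < c ->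
  exists z, [/\ S z, `|z| <= 1 & `|e| <= c * iota e z].
Proof.
have [il _ _ _ nE] := hi => c1.
have c0 : 0 < c by exact: lt_trans c1.
have [->|e0] := eqVneq e 0.
  exists 0; rewrite !normr0; split=> //; first by case: sS.
  by rewrite dual_rep0 mulr0.
have ne : 0 < `|e| by rewrite normr_gt0.
have de : 0 < `|e| - `|e| / c by rewrite subr_gt0 ltr_pdivrMr// ltr_pMr.
have [_ [z [Sz z1 ->]]] := sup_adherent de (dual_rep_has_sup e).
rewrite -nE subKr ltr_pdivrMr// => hz.
have [i_ge0|i_lt0] := leP 0 (iota e z).
  by exists z; split=> //; rewrite mulrC -(ger0_norm i_ge0) ltW.
exists ((-1) *: z); split; first exact: subspaceZ.
  by rewrite scaleN1r normrN.
by rewrite (lin_onZ _ _ _ _ _ sS (il e) Sz) mulN1r -(ltr0_norm i_lt0) mulrC ltW.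
Qed.

Lemma dual_rep_sum (I : Type) (r : seq I) (P : pred I) (a : I -> RR) (x : I -> E) z :
  S z -> iota (\sum_(i <- r | P i) a i *: x i) z = \sum_(i <- r | P i) a i * iota (x i) z.
Proof.
have [_ _ ie _ _] := hi => Sz.
have := @linear_on_sum E RR^o setT (iota ^~ z) I r P a x; apply=> //.
by move=> c u v _ _; exact: ie.
Qed.

Lemma dual_rep_sumr (I : Type) (r : seq I) (P : pred I) (a : I -> RR) (x : I -> Z) e :
  (forall i, P i -> S (x i)) ->
  iota e (\sum_(i <- r | P i) a i *: x i) = \sum_(i <- r | P i) a i * iota e (x i).
Proof.
have [il _ _ _ _] := hi => Sx.
exact: (@linear_on_sum Z RR^o S (iota e) I r P a x sS (il e)).
Qed.

Lemma dual_rep_exists (g : Z -> RR) M : lin_on Z S g ->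
  (forall x y, `|g x - g y| <= M * `|x - y|) -> exists e, forall z, S z -> iota e z = g z.
Proof.
have [_ _ _ h _] := hi => gl gM; apply: h => //.
by apply: continuous_subspaceT; exact: (@lipschitz_continuous Z RR^o g M gM).
Qed.

End DualRep.

(** If [D] has at most one point there are no quotients and the [sup] is 0 by convention; [0 <= M]
    covers that case. *)
Lemma lipnorm_le (E F : normedModType RR) (D : set E) (f : E -> F) M : 0 <= M ->
  (forall x y, D x -> D y -> `|f x - f y| <= M * `|x - y|) -> lipnorm E F D f <= M.
Proof.
move=> M0 h; rewrite /lipnorm; set A := [set _ | _].
have [A0|/set0P/negP] := pselect (A !=set0); last first.
  by rewrite negbK => /eqP ->; rewrite sup0.
apply: ge_sup => // _ [x [y [Dx Dy /eqP xy ->]]].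
by rewrite ler_pdivrMr ?normr_gt0 ?subr_eq0//; exact: h.
Qed.

Lemma lipnorm_bound (E F : normedModType RR) (D : set E) (f : E -> F) :
  (exists L : RR, forall x y, D x -> D y -> `|f x - f y| <= L * `|x - y|) ->
  forall x y, D x -> D y -> `|f x - f y| <= lipnorm E F D f * `|x - y|.
Proof.
move=> [L h] x y Dx Dy; have [->|xy] := eqVneq x y; first by rewrite !subrr !normr0 mulr0.
have nxy : 0 < `|x - y| by rewrite normr_gt0 subr_eq0.
rewrite -ler_pdivrMr//; apply: ub_le_sup.
  exists L => _ [u [v [Du Dv /eqP uv ->]]].
  by rewrite ler_pdivrMr ?normr_gt0 ?subr_eq0//; exact: h.
by exists x, y; split=> //; exact/eqP.
Qed.

Lemma lipnorm_ge0 (E F : normedModType RR) (D : set E) (f : E -> F) : 0 <= lipnorm E F D f.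
Proof.
rewrite /lipnorm; set A := [set _ | _].
have [[[r Ar] ubA]|/sup_out ->//] := pselect (has_sup A).
apply: le_trans (ub_le_sup ubA Ar).
by case: Ar => x [y [_ _ _ ->]]; rewrite divr_ge0.
Qed.

(** * Local reflexivity *)

(* If no [y] works, separating the constraints yields functionals [w k] on [Y]
   with [sum_k a k i *: w k = 0] at the free indices and
   [1 <= sum_k i2 (sum_i a k i *: b i) (w k) <= sum_k r k * |w k| / t < 1]. *)
Lemma helly_finite (X : normedModType RR) (Y : set X) (sY : subspace X Y)
    (W : normedModType RR) (iY : W -> X -> RR) (hiY : dual_rep_on X W Y iY)
    (U : normedModType RR) (i2 : U -> W -> RR) (hi2 : dual_rep_on W U setT i2)
    (n : nat) (b : 'I_n -> U) (fixd : pred 'I_n) (y0 : 'I_n -> X)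
    (Yy0 : forall i, fixd i -> Y (y0 i))
    (by0 : forall i, fixd i -> forall w, i2 (b i) w = iY w (y0 i))
    (K : finType) (a : K -> 'I_n -> RR) (r : K -> RR) (t : RR) (t1 : 1 < t)
    (r0 : forall k, 0 < r k) (hr : forall k, t * `|\sum_i a k i *: b i| <= r k) :
  exists y : 'I_n -> X, [/\ forall i, Y (y i), forall i, fixd i -> y i = y0 i
    & forall k, `|\sum_i a k i *: y i| <= r k].
Proof.
pose V := {ffun K -> X}.
(* Weighted maximum norm on the power of [X]: all constraints hold exactly when [N] is at most 1.
   Starting the maximum at 0 covers an empty [K]. *)
pose N (z : V) : RR := \big[Num.max/0]_k (`|z k| / r k).
pose A (y : 'I_n -> X) : V := [ffun k => \sum_i a k i *: y i].
(* The attainable tuples form the affine set [b0 + M]: [b0] collects the prescribed vectors and [M]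
   the freedom in the others. *)
pose M : set V := [set z | exists y, [/\ forall i, Y (y i), forall i, fixd i -> y i = 0 & z = A y]].
pose b0 : V := [ffun k => \sum_(i | fixd i) a k i *: y0 i].
have [S0 Sl] := sY.
have N0 (z : V) : 0 <= N z by apply/bigmax_geP; left.
have Nk (z : V) k : `|z k| <= N z * r k.
  by rewrite -ler_pdivrMr//; exact: (le_bigmax _ (fun k => `|z k| / r k)).
have Nle (z : V) c : 0 <= c -> (forall k, `|z k| <= c * r k) -> N z <= c.
  move=> c0 h; apply: bigmax_le => // k _; by rewrite ler_pdivrMr.
have ND (x y : V) : N (x + y) <= N x + N y.
  apply: Nle; first by rewrite addr_ge0.
  move=> k; rewrite ffunE mulrDl; apply: le_trans (ler_normD _ _) _.
  by rewrite lerD.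
have NZle s (x : V) : N (s *: x) <= `|s| * N x.
  apply: Nle; first by rewrite mulr_ge0.
  by move=> k; rewrite ffunE normrZ -mulrA ler_wpM2l.
have NZ s (x : V) : N (s *: x) = `|s| * N x.
  apply/eqP; rewrite eq_le NZle/=.
  have [->|s0] := eqVneq s 0; first by rewrite normr0 mul0r.
  rewrite mulrC -ler_pdivlMr ?normr_gt0// mulrC -normfV.
  by have := NZle s^-1 (s *: x); rewrite scalerA mulVf// scale1r.
apply: contrapT => noy.
have Nb (m : V) : M m -> 1 <= N (b0 + m).
  move=> [y [Yy yf ->]]; rewrite leNgt; apply/negP => lt1; apply: noy.
  exists (fun i => if fixd i then y0 i else y i); split.
  - by move=> i; case: ifPn => // fi; exact: Yy0.
  - by move=> i ->.
  move=> k; have -> : \sum_i a k i *: (if fixd i then y0 i else y i) = (b0 + A y) k.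
    rewrite !ffunE [in LHS](bigID fixd) /= [X in _ = _ + X](bigID fixd) /=.
    rewrite [X in _ = _ + (X + _)]big1 => [|i fi]; last by rewrite yf// scaler0.
    by rewrite add0r; congr (_ + _); apply: eq_bigr => i; [move=> -> | move=> /negbTE ->].
  by apply: le_trans (Nk _ k) _; rewrite ger_pMl// ltW.
have M0 : M 0.
  exists (fun=> 0); split=> //; apply/ffunP => k; rewrite !ffunE big1// => i _.
  by rewrite scaler0.
have Ml (c : RR) (x y : V) : M x -> M y -> M (c *: x + y).
  move=> [x' [Yx x0 ->]] [y' [Yy yy0 ->]]; exists (fun i => c *: x' i + y' i); split.
  - by move=> i; exact: Sl.
  - by move=> i fi; rewrite x0// yy0// scaler0 addr0.
  apply/ffunP => k; rewrite !ffunE scaler_sumr -big_split /=; apply: eq_bigr => i _.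
  by rewrite scalerDr !scalerA mulrC.
have [L [Llin LN LM Lb]] := dual_distance ({ffun K -> X} : lmodType RR) N M b0 N0 ND NZ M0 Ml Nb.
pose dl k (x : X) : V := [ffun l => if l == k then x else 0].
(* The separating functional splits into coordinates, each bounded by [(r k)^-1]; their restrictions
   to [Y] are the [w k]. *)
pose g k x := L (dl k x).
have dlin k c x y : dl k (c *: x + y) = c *: dl k x + dl k y.
  by apply/ffunP => l; rewrite !ffunE; case: ifP => // _; rewrite scaler0 addr0.
have glin k c x y : g k (c *: x + y) = c * g k x + g k y by rewrite /g dlin Llin.
have gle k x : g k x <= (r k)^-1 * `|x|.
  apply: le_trans (LN _) _; apply: Nle; first by rewrite mulr_ge0// invr_ge0 ltW.
  move=> l; rewrite ffunE; case: eqP => [->|_].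
    by rewrite mulrC mulrA divff ?mul1r// gt_eqF.
  by rewrite normr0 !mulr_ge0// ?invr_ge0 ltW.
have gB k x y : g k x - g k y = g k (x - y).
  by have := glin k (-1) y x; rewrite scaleN1r mulN1r [- y + x]addrC => ->; rewrite addrC.
have gn k x y : `|g k x - g k y| <= (r k)^-1 * `|x - y|.
  rewrite ler_norml; apply/andP; split; last by rewrite gB.
  by rewrite lerNl opprB gB distrC.
have /choice [w hw] : forall k, exists e, forall z, Y z -> iY e z = g k z.
  move=> k; apply: (dual_rep_exists hiY (g k) _ _ (gn k)).
  by move=> c z1 z2 _ _.
have Lsum (z : V) : L z = \sum_k g k (z k).
  have -> : z = \sum_k 1 *: dl k (z k).
    apply/ffunP => l; rewrite sum_ffunE (bigD1 l)//= big1 => [|k kl].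
      by rewrite !ffunE eqxx scale1r addr0.
    by rewrite !ffunE eq_sym (negbTE kl) scaler0.
  have lsum := @linear_on_sum ({ffun K -> X} : lmodType RR) RR^o setT L.
  rewrite lsum; first 1 last.
  - exact: subspaceT.
  - by move=> c u v _ _; exact: Llin.
  - by [].
  apply: eq_bigr => k _; rewrite [_ *: _]mul1r; congr (g k _).
  rewrite sum_ffunE (bigD1 k)//= big1 => [|l kl].
    by rewrite !ffunE eqxx scale1r addr0.
  by rewrite !ffunE eq_sym (negbTE kl) scaler0.
(* [L] kills every tuple generated by one vector of [Y] placed at the free index [i]. *)
have w0 i : ~~ fixd i -> \sum_k a k i *: w k = 0.
  move=> fi; apply: (dual_rep_inj sY hiY) => z Yz.
  rewrite (dual_rep_sum hiY)//.
  have -> : iY 0 z = 0.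
    have := dual_rep_bound sY hiY 0 z Yz.
    by rewrite normr0 mul0r normr_le0 => /eqP.
  pose y j := if j == i then z else 0.
  have Ay0 : L (A y) = 0.
    apply: LM; exists y; split=> // j; rewrite /y; case: eqP => // ->.
    by rewrite (negbTE fi).
  rewrite -[RHS]Ay0 Lsum; apply: eq_bigr => k _; rewrite hw// ffunE (bigD1 i)//= big1 => [|j ji].
    rewrite /y eqxx; have := glin k (a k i) z 0; rewrite !addr0 => ->.
    suff -> : g k 0 = 0 by rewrite addr0.
    by have := gB k 0 0; rewrite !subrr => <-.
  by rewrite /y (negbTE ji) scaler0.
(* At fixed indices [b i] acts as evaluation at [y0 i]; the free indices may be added because they
   contribute 0 by [w0]. *)
have Lb0 : L b0 = \sum_k i2 (\sum_i a k i *: b i) (w k).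
  rewrite Lsum; transitivity (\sum_k \sum_(i | fixd i) a k i * i2 (b i) (w k)).
    apply: eq_bigr => k _; rewrite ffunE.
    have Ys : Y (\sum_(i | fixd i) a k i *: y0 i) by exact: subspace_sum.
    rewrite -hw// (dual_rep_sumr sY hiY)//; apply: eq_bigr => i fi.
    by rewrite by0.
  transitivity (\sum_k \sum_i a k i * i2 (b i) (w k)); last first.
    by apply: eq_bigr => k _; rewrite (dual_rep_sum hi2).
  rewrite exchange_big [RHS]exchange_big /= [RHS](bigID fixd) /=.
  rewrite [X in _ = _ + X]big1 ?addr0// => i fi.
  rewrite -(dual_rep_sumr (subspaceT W) hi2)// w0//.
  exact: (dual_rep0 (subspaceT W) hi2).
(* Norming vectors lose a factor [s]; placing it strictly below [t] makes [t <= t * L b0 <= s]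
   absurd. *)
pose s := (1 + t) / 2.
have s1 : 1 < s by rewrite /s; lra.
have st : s < t by rewrite /s; lra.
have t0 : 0 < t by lra.
have /choice [z hz] k := dual_rep_norming sY hiY (w k) s s1.
have iwz k : 0 <= iY (w k) (z k).
  have [_ _ h] := hz k; rewrite -(pmulr_rge0 _ (lt_trans ltr01 s1)).
  exact: le_trans h.
(* The tuple of the [r k *: z k] has [N] at most 1, so testing [L] on it bounds the sum of the
   [r k * |w k|] by [s]. *)
have Lz : \sum_k r k * iY (w k) (z k) <= 1.
  pose zz : V := [ffun k => r k *: z k].
  have <- : L zz = \sum_k r k * iY (w k) (z k).
    rewrite Lsum; apply: eq_bigr => k _; have [Yz _ _] := hz k.
    rewrite ffunE hw//; have := glin k (r k) (z k) 0; rewrite !addr0 => ->.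
    suff -> : g k 0 = 0 by rewrite addr0.
    by have := gB k 0 0; rewrite !subrr => <-.
  apply: le_trans (LN _) _; apply: Nle => // k; rewrite ffunE normrZ gtr0_norm//.
  by have [_ z1 _] := hz k; rewrite mul1r ger_pMr.
have : t * L b0 <= s.
  rewrite Lb0 mulr_sumr; apply: le_trans (_ : _ <= s * \sum_k r k * iY (w k) (z k)) _; last first.
    by rewrite ger_pMr//; lra.
  rewrite mulr_sumr; apply: ler_sum => k _; have [_ _ h] := hz k.
  apply: le_trans (_ : _ <= t * (`|\sum_i a k i *: b i| * `|w k|)) _.
    rewrite ler_pM2l//; apply: le_trans (ler_norm _) _.
    exact: (dual_rep_bound (subspaceT W) hi2).
  rewrite [leLHS]mulrA [leRHS]mulrCA; apply: ler_pM => //.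
  by rewrite mulr_ge0// ltW.
have : t <= t * L b0 by rewrite ler_pMr.
lra.
Qed.

(** The vectors marked by [fixd] form a basis of the intersection of the span with [S]. Induction on
    [s]: a vector outside the span is replaced by its component in [S] if it is congruent to one
    modulo the span; otherwise it is adjoined unmarked and the intersection does not grow. Indexing
    by [nat] avoids casts when a vector is appended. *)
Lemma adapted_basis (U : lmodType RR) (S : set U) (s : seq U) : subspace U S ->
  exists (n : nat) (b : nat -> U) (fixd : nat -> bool), [/\
    forall i, fixd i -> S (b i),
    forall a : nat -> RR, \sum_(i < n) a i *: b i = 0 -> forall i, (i < n)%N -> a i = 0,
    forall a : nat -> RR, S (\sum_(i < n) a i *: b i) ->
      forall i, (i < n)%N -> ~~ fixd i -> a i = 0
  & forall u, u \in s -> exists a : nat -> RR, u = \sum_(i < n) a i *: b i].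
Proof.
move=> sS; have [S0 Sl] := sS; elim: s => [|v s [n [b [fixd [bS ind indS sp]]]]].
  by exists 0%N, (fun=> 0), (fun=> false); split.
pose span u := exists a : nat -> RR, u = \sum_(i < n) a i *: b i.
have spanB a u w : span u -> span w -> span (a *: u + w).
  move=> [c ->] [c' ->]; exists (fun i => a * c i + c' i).
  rewrite scaler_sumr -big_split /=; apply: eq_bigr => i _.
  by rewrite scalerDl scalerA.
have [sv|nsv] := pselect (span v).
  exists n, b, fixd; split=> // u; rewrite inE => /predU1P[->//|]; exact: sp.
(* [b'] appends [w] to [b]; it spans [v] when [v = u + w] or [v = w] *)
pose b' w i := if (i < n)%N then b i else w.
pose f' (c : bool) i := if (i < n)%N then fixd i else (i == n) && c.
have sumb' w (a : nat -> RR) :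
    \sum_(i < n.+1) a i *: b' w i = \sum_(i < n) a i *: b i + a n *: w.
  rewrite big_ord_recr /= /b' ltnn; congr (_ + _).
  by apply: eq_bigr => i _; rewrite ltn_ord.
have ext w (c : nat -> RR) t : exists a : nat -> RR,
    \sum_(i < n.+1) a i *: b' w i = \sum_(i < n) c i *: b i + t *: w.
  pose a i := if (i < n)%N then c i else t.
  exists a; rewrite sumb' /a ltnn; congr (_ + _).
  by apply: eq_bigr => i _; rewrite ltn_ord.
have ind' w : ~ span w -> forall a : nat -> RR, \sum_(i < n.+1) a i *: b' w i = 0 ->
    forall i, (i < n.+1)%N -> a i = 0.
  move=> nw a; rewrite sumb' => e.
  have an : a n = 0.
    apply: contrapT => /eqP an; apply: nw; exists (fun i => - (a n)^-1 * a i).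
    under eq_bigr do rewrite -scalerA.
    rewrite -scaler_sumr (_ : \sum_(_ < _) _ = - (a n *: w)); last first.
      by apply/eqP; rewrite -addr_eq0 e.
    by rewrite scaleNr scalerN opprK scalerA mulVf// scale1r.
  move: e; rewrite an scale0r addr0 => e i; rewrite ltnS leq_eqVlt => /predU1P[->//|].
  exact: ind.
have sp' w : (exists2 u, span u & v = u + w) ->
    forall u, u \in v :: s -> exists a : nat -> RR, u = \sum_(i < n.+1) a i *: b' w i.
  move=> [_ [c ->] ->] u; rewrite inE => /predU1P[->|].
    by have [a ea] := ext w c 1; exists a; rewrite ea scale1r.
  by move=> /sp[c' ->]; have [a ea] := ext w c' 0; exists a; rewrite ea scale0r addr0.
have span0 : span 0.
  by exists (fun=> 0); rewrite big1// => i _; rewrite scale0r.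
have [[u su [w Sw e]]|nv] := pselect (exists2 u, span u & exists2 w, S w & v = u + w).
  have nw : ~ span w.
    by move=> sw; apply: nsv; rewrite e -[u]scale1r; exact: spanB.
  exists n.+1, (b' w), (f' true); split; [|exact: ind'| |by apply: sp'; exists u].
    by move=> i; rewrite /f' /b'; case: ifPn => // _; exact: bS.
  move=> a; rewrite sumb' => Sa.
  have Sa' : S (\sum_(i < n) a i *: b i).
    rewrite -[X in S X](addrK (a n *: w)) addrC -scaleNr; exact: Sl.
  move=> i; rewrite ltnS leq_eqVlt /f' => /predU1P[->|lin].
    by rewrite ltnn eqxx.
  by rewrite lin; exact: indS.
exists n.+1, (b' v), (f' false); split; [|exact: ind'| |by apply: sp'; exists 0; rewrite ?add0r].
  move=> i; rewrite /f' /b'; case: ifPn => [_|]; first exact: bS.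
  by rewrite andbF.
move=> a; rewrite sumb' => Sa.
(* A nonzero last coefficient would write [v] as a vector of the span plus one of [S]. *)
have an : a n = 0.
  apply: contrapT => /eqP an; apply: nv.
  exists (- (a n)^-1 *: (\sum_(i < n) a i *: b i)).
    rewrite -[_ *: _]addr0; apply: spanB => //; by exists a.
  exists ((a n)^-1 *: (\sum_(i < n) a i *: b i + a n *: v)); first exact: subspaceZ.
  by rewrite scalerDr scalerA mulVf// scale1r scaleNr addKr.
move: Sa; rewrite an scale0r addr0 => Sa i; rewrite ltnS leq_eqVlt /f' => /predU1P[->//|lin].
by rewrite lin; exact: indS.
Qed.

(** * Finite-dimensional coordinates and compactness *)

Definition comb (V : lmodType RR) (n : nat) (y : 'I_n -> V) (a : 'rV[RR]_n) : V :=
  \sum_i a ord0 i *: y i.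

Lemma comb_linear (V : lmodType RR) n (y : 'I_n -> V) c a a' :
  comb V n y (c *: a + a') = c *: comb V n y a + comb V n y a'.
Proof.
rewrite /comb scaler_sumr -big_split /=; apply: eq_bigr => i _.
by rewrite !mxE scalerDl scalerA.
Qed.

Lemma comb0 (V : lmodType RR) n (y : 'I_n -> V) : comb V n y 0 = 0.
Proof. by rewrite /comb big1// => i _; rewrite mxE scale0r. Qed.

Lemma combZ (V : lmodType RR) n (y : 'I_n -> V) c a :
  comb V n y (c *: a) = c *: comb V n y a.
Proof. by have := comb_linear V n y c a 0; rewrite comb0 !addr0. Qed.

Lemma combB (V : lmodType RR) n (y : 'I_n -> V) a a' :
  comb V n y (a - a') = comb V n y a - comb V n y a'.
Proof. by have := comb_linear V n y (-1) a' a; rewrite !scaleN1r addrC => ->; rewrite addrC. Qed.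

Lemma comb_norm_le (V : normedModType RR) n (y : 'I_n -> V) a :
  `|comb V n y a| <= `|a| * \sum_i `|y i|.
Proof.
apply: le_trans (ler_norm_sum _ _ _) _; rewrite mulr_sumr; apply: ler_sum => i _.
rewrite normrZ ler_wpM2r// [leRHS]/Num.norm /= mx_normrE.
exact: (le_bigmax _ (fun i : 'I_1 * 'I_n => `|a i.1 i.2|) (ord0, i)).
Qed.

Lemma comb_lipschitz (V : normedModType RR) n (y : 'I_n -> V) a a' :
  `|comb V n y a - comb V n y a'| <= (\sum_i `|y i|) * `|a - a'|.
Proof. by rewrite -combB mulrC comb_norm_le. Qed.

Lemma rV_sphere_compact n : compact [set a : 'rV[RR]_n | `|a| = 1].
Proof.
apply: bounded_closed_compact.
  by exists 1; split=> // x x1 a /= ->; exact: ltW.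
have /continuous_closedP := @norm_continuous RR 'rV[RR]_n.
by move=> /(_ [set 1] (@closed_eq _ _)).
Qed.

Lemma rV_ball_compact n (r : RR) : compact [set a : 'rV[RR]_n | `|a| <= r].
Proof.
apply: bounded_closed_compact.
  by exists r; split=> [|x x1 a /= ar]; [exact: num_real | exact: le_trans (ltW x1)].
have /continuous_closedP := @norm_continuous RR 'rV[RR]_n.
by move=> /(_ [set x | x <= r] (@closed_le _ _)).
Qed.

(** The norm of the combination attains a minimum on the compact unit sphere, positive by
    independence. For [n = 0] the sphere is empty and any constant works. *)
Lemma comb_lower_bound (V : normedModType RR) n (b : 'I_n -> V) :
  (forall a, comb V n b a = 0 -> a = 0) ->
  exists2 c : RR, 0 < c & forall a : 'rV[RR]_n, c * `|a| <= `|comb V n b a|.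
Proof.
move=> ind; have [[a0 a00]|all0] := pselect (exists a : 'rV[RR]_n, a != 0); last first.
  exists 1 => // a; have [->|a1] := eqVneq a 0; first by rewrite normr0 mulr0.
  by exfalso; apply: all0; exists a.
have unit (a : 'rV[RR]_n) : a != 0 -> `| `|a|^-1 *: a| = 1.
  by move=> an0; rewrite normrZ normfV normr_id mulVf ?normr_eq0.
have cf : continuous (fun a : 'rV[RR]_n => `|comb V n b a| : RR).
  apply: (@lipschitz_continuous _ RR^o _ (\sum_i `|b i|)) => x y.
  exact: le_trans (ler_dist_dist _ _) (comb_lipschitz _ _ _ _ _).
have [|m Km mmin] := compact_EVT_min _ (rV_sphere_compact n) (continuous_subspaceT cf).
  by exists (`|a0|^-1 *: a0); exact: unit.
move: Km; rewrite inE /= => m1.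
exists `|comb V n b m|.
  rewrite normr_gt0; apply/eqP => /ind m0; move: m1; rewrite m0 normr0; lra.
move=> a; have [->|an0] := eqVneq a 0; first by rewrite normr0 mulr0.
have := mmin (`|a|^-1 *: a); rewrite inE => /(_ (unit a an0)).
by rewrite combZ normrZ normfV normr_id mulrC ler_pdivlMr ?normr_gt0.
Qed.

Lemma comb_range_closed (V : normedModType RR) n (b : 'I_n -> V) c : 0 < c ->
  (forall a : 'rV[RR]_n, c * `|a| <= `|comb V n b a|) -> closed (range (comb V n b)).
Proof.
move=> c0 hc u clu.
(* This ball contains the coordinates of every combination within distance 1 of [u], so [u] already
   adheres to the image of a compact set. *)
pose B := [set a : 'rV[RR]_n | `|a| <= c^-1 * (`|u| + 1)].
have cL : continuous (comb V n b).
  exact: (lipschitz_continuous _ _ _ _ (comb_lipschitz V n b)).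
have KB : compact (comb V n b @` B).
  by apply: continuous_compact (rV_ball_compact _ _); exact: continuous_subspaceT.
suff [a _ <-] : (comb V n b @` B) u by exists a.
apply: (compact_closed (@norm_hausdorff _ V) KB) => A Au.
have [|_ [[a _ <-] [Aa bu]]] := clu (A `&` ball u 1).
  by apply: filterI => //; exact: nbhsx_ballx.
exists (comb V n b a); split=> //; exists a => //.
rewrite /B /= ler_pdivlMl//; apply: le_trans (hc a) _.
move: bu; rewrite -ball_normE /= => bu.
have := ler_distD u (comb V n b a) 0; rewrite !subr0 distrC; lra.
Qed.

Lemma sphere_net n (d : RR) : 0 < d -> exists (K : finType) (p : K -> 'rV[RR]_n),
  (forall k, `|p k| = 1) /\ forall a : 'rV[RR]_n, `|a| = 1 -> exists k, `|a - p k| < d.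
Proof.
move=> d0; have := rV_sphere_compact n; rewrite compact_cover.
move=> /(_ _ [set a : 'rV[RR]_n | `|a| = 1] (fun a => ball a d)).
case=> [a _|a a1|D' D'1 cov].
- exact: ball_open.
- by exists a => //; exact: ballxx.
exists (seq_sub (finmap.enum_fset D')), val; split=> [k|a a1].
  by have := D'1 _ (valP k); rewrite inE.
have [k kD] := cov a a1; rewrite -ball_normE /= distrC => kd.
by exists (SeqSub (kD : k \in finmap.enum_fset D')).
Qed.

Lemma local_reflexivity (X : normedModType RR) (Y : set X) (sY : subspace X Y)
    (W : normedModType RR) (iY : W -> X -> RR) (hiY : dual_rep_on X W Y iY)
    (U : normedModType RR) (i2 : U -> W -> RR) (hi2 : dual_rep_on W U setT i2)
    (s : seq U) (eps : RR) : 0 < eps ->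
  exists (D : set U) (T : U -> X), [/\ closed_subspace U D,
    forall u, u \in s -> D u,
    (forall u, D u -> Y (T u)) /\
    (forall a u v, D u -> D v -> T (a *: u + v) = a *: T u + T v),
    forall u, D u -> `|T u| <= (1 + eps) * `|u|
  & forall u y, D u -> Y y -> (forall w, i2 u w = iY w y) -> T u = y].
Proof.
move=> eps0; have [Y0 Yl] := sY.
(* This is the copy [j Y] of [Y] inside the bidual. *)
pose S : set U := [set u | exists2 y, Y y & forall w, i2 u w = iY w y].
have sS : subspace U S.
  split.
    exists 0 => // w; rewrite (dual_rep0 sY hiY).
    have := dual_rep_bound (subspaceT W) hi2 0 w I.
    by rewrite normr0 mul0r normr_le0 => /eqP.
  move=> a u v [y Yy uy] [y' Yy' uy'].

  exists (a *: y + y') => [|w]; first exact: Yl.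
  have [iYl _ _ _ _] := hiY; have [_ _ i2l _ _] := hi2.
  by rewrite iYl// i2l// uy uy'.
have [n [b [fixd [bS ind indS sp]]]] := adapted_basis U S s sS.
pose bb (i : 'I_n) := b i.
have natcomb (a : nat -> RR) : \sum_(i < n) a i *: b i = comb U n bb (\row_i a i).
  by apply: eq_bigr => i _; rewrite mxE.
have [nf nfE] : exists nf : 'rV[RR]_n -> nat -> RR, forall a (i : 'I_n), nf a i = a ord0 i.
  exists (fun a i => if insub i is Some j then a ord0 j else 0) => a i.
  by rewrite valK.
have combnat a : comb U n bb a = \sum_(i < n) nf a i *: b i.
  by apply: eq_bigr => i _; rewrite nfE.
have indb a : comb U n bb a = 0 -> a = 0.
  rewrite combnat => /ind h; apply/rowP => i; rewrite mxE -nfE; exact: h.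
have indSb a (i : 'I_n) : S (comb U n bb a) -> ~~ fixd i -> a ord0 i = 0.
  by rewrite combnat -nfE => /indS h; apply: h.
have [c c0 hc] := comb_lower_bound U n bb indb.
have /choice[y0 hy0] (i : 'I_n) : exists y, fixd i ->
    Y y /\ forall w, i2 (bb i) w = iY w y.
  case: (boolP (fixd i)) => [/bS[y Yy hy]|_]; last by exists 0.
  by exists y; split.
(* [B] dominates the sum of the norms of the basis and, up to the factor [t], that of its future
   images; the leading 1 keeps it positive when [n = 0]. *)
pose B : RR := 1 + \sum_i (`|bb i| + 1).
have Bb : \sum_i `|bb i| <= B.
  rewrite /B -[leLHS]add0r lerD// ler_sum// => i _; lra.
have B0 : 0 < B by rewrite ltr_pwDl// sumr_ge0// => i _; rewrite addr_ge0.
pose t : RR := 1 + eps / 2.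
have t1 : 1 < t by rewrite /t; lra.
have t0 : 0 < t by lra.
(* Moving to the net and back costs [d * (t * B)] twice, in total [eps / 2 * c], which the lower
   bound [c] on the sphere absorbs. *)
pose d : RR := eps / 2 * c / (2 * t * B).
have d0 : 0 < d by rewrite !(divr_gt0, mulr_gt0).
have [K [p [p1 pnet]]] := sphere_net n d d0.
(* Besides the net points, each basis vector is a constraint of its own: this bounds the images
   independently of the net, so the mesh [d] could be fixed beforehand. *)
pose al (k : K + 'I_n) i := match k with inl k => p k ord0 i | inr j => (i == j)%:R end : RR.
pose r (k : K + 'I_n) : RR := t * match k with inl k => `|comb U n bb (p k)| | inr j => `|bb j| + 1 end.
have alr (V : lmodType RR) (z : 'I_n -> V) j : \sum_i al (inr j) i *: z i = z j.
  rewrite (bigD1 j)//= eqxx scale1r big1 ?addr0// => i /negbTE ->.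
  by rewrite scale0r.
have [||y [Yy yf hy]] := helly_finite X Y sY W iY hiY U i2 hi2 n bb (fun i => fixd i) y0
    (fun i fi => (hy0 i fi).1) (fun i fi => (hy0 i fi).2) (K + 'I_n)%type al r t t1.
- move=> [k|j]; rewrite /r mulr_gt0// ?ltr_wpDl//.
  by apply: lt_le_trans (hc _); rewrite p1 mulr1.
- move=> [k|j]; rewrite /r ler_pM2l//.
  by rewrite alr; lra.
have yj (j : 'I_n) : `|y j| <= t * (`|bb j| + 1).
  by have := hy (inr j); rewrite alr.
have yB : \sum_i `|y i| <= t * B.
  rewrite /B mulrDr mulr_sumr -[leLHS]add0r lerD//; first by rewrite mulr1 ltW.
  by apply: ler_sum => i _.
have yp k : `|comb X n y (p k)| <= t * `|comb U n bb (p k)| by exact: (hy (inl k)).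
have sphere_le (a : 'rV[RR]_n) : `|a| = 1 -> `|comb X n y a| <= (1 + eps) * `|comb U n bb a|.
  move=> a1; have [k ak] := pnet a a1.
  have e1 : `|comb X n y a| <= `|comb X n y (p k)| + d * (t * B).
    rewrite -{1}(subrK (p k) a) addrC.
    have := comb_linear X n y 1 (p k) (a - p k); rewrite !scale1r => ->.
    apply: le_trans (ler_normD _ _) _; rewrite lerD2l.
    apply: le_trans (comb_norm_le _ _ _ _) _.
    by apply: ler_pM => //; [exact: sumr_ge0 | exact: ltW].
  have e2 : `|comb U n bb (p k)| <= `|comb U n bb a| + d * B.
    rewrite -{1}(subrK a (p k)) addrC.
    have := comb_linear U n bb 1 a (p k - a); rewrite !scale1r => ->.
    apply: le_trans (ler_normD _ _) _; rewrite lerD2l.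
    apply: le_trans (comb_norm_le _ _ _ _) _.
    by rewrite distrC; apply: ler_pM => //; [exact: sumr_ge0 | exact: ltW].
  have e3 : 2 * (d * (t * B)) = eps / 2 * c.
    by rewrite /d; field; rewrite !gt_eqF.
  have e4 : eps / 2 * c <= eps / 2 * `|comb U n bb a|.
    by rewrite ler_pM2l ?divr_gt0//; have := hc a; rewrite a1 mulr1.
  have e5 : t * `|comb U n bb (p k)| <= t * `|comb U n bb a| + d * (t * B).
    by rewrite [d * _]mulrCA -mulrDr ler_pM2l.
  have -> : 1 + eps = t + eps / 2 by rewrite /t; lra.
  apply: le_trans e1 _; apply: le_trans (lerD (yp k) (lexx _)) _.
  apply: le_trans (lerD e5 (lexx _)) _; rewrite -addrA [leRHS]mulrDl lerD2l.
  by apply: le_trans e4; rewrite -e3 mulr_natl mulr2n.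
have comb_le (a : 'rV[RR]_n) : `|comb X n y a| <= (1 + eps) * `|comb U n bb a|.
  have [->|a0] := eqVneq a 0; first by rewrite !comb0 !normr0 mulr0.
  have na : 0 < `|a| by rewrite normr_gt0.
  have := sphere_le (`|a|^-1 *: a).
  rewrite !combZ !normrZ normfV normr_id mulVf ?gt_eqF// => /(_ erefl).
  by rewrite mulrCA ler_pM2l// invr_gt0.
have [co coK] : exists co : U -> 'rV[RR]_n, forall a, co (comb U n bb a) = a.
  exists (fun u => xget 0 [set a | comb U n bb a = u]) => a.
  case: xgetP => [a' _ /= e|/(_ a)/=]; last by [].
  by apply/eqP; rewrite -subr_eq0; apply/eqP/indb; rewrite combB e subrr.
exists (range (comb U n bb)), (fun u => comb X n y (co u)); split.
- split; first exact: comb_range_closed hc.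
    by exists 0 => //; exact: comb0.
  move=> a _ _ [x _ <-] [x' _ <-]; exists (a *: x + x') => //; exact: comb_linear.
- by move=> u /sp[a ->]; rewrite natcomb; exists (\row_i a i).
- split=> [_ [a _ <-]|a _ _ [x _ <-] [x' _ <-]]; first by apply: subspace_sum => // i _.
  by rewrite -comb_linear !coK comb_linear.
- by move=> _ [a _ <-]; rewrite coK.
move=> _ z [a _ <-] Yz hz; rewrite coK.
have Sa : S (comb U n bb a) by exists z.
(* Functionals on [Y] separate points: [dual_distance] with [M] reduced to 0 and the norm rescaled
   to be 1 at [z1]. *)
have jsep (z1 : X) : Y z1 -> (forall w, iY w z1 = 0) -> z1 = 0.
  move=> Yz1 h; apply: contrapT => /eqP z10.
  have nz : 0 < `|z1| by rewrite normr_gt0.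
  have [x|x x'|c' x||c' x x' -> ->|m ->|g [gl gN _ g1]] :=
    @dual_distance X (fun x => `|z1|^-1 * `|x|) [set 0] z1.
  - by rewrite mulr_ge0// invr_ge0.
  - by rewrite -mulrDr ler_pM2l ?invr_gt0// ler_normD.
  - by rewrite normrZ mulrCA.
  - by [].
  - by rewrite scaler0 addr0.
  - by rewrite addr0 mulVf// gt_eqF.
  have gB x x' : g x - g x' = g (x - x').
    by have := gl (-1) x' x; rewrite scaleN1r mulN1r [- x' + x]addrC => ->; rewrite addrC.
  have [|x x'|w hw] := dual_rep_exists hiY g (`|z1|^-1).
  - by move=> c' x x' _ _.
  - rewrite ler_norml; apply/andP; split; last by rewrite gB.
    by rewrite lerNl opprB gB distrC.
  by have := hw z1 Yz1; rewrite h; lra.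
(* It remains to compare values at each [w]: fixed basis vectors go to their points of [Y], and the
   free coordinates vanish since the vector lies in [S]. *)
apply/eqP; rewrite -subr_eq0; apply/eqP; apply: jsep.
  rewrite addrC -scaleN1r; apply: Yl => //; by apply: subspace_sum => // i _.
move=> w; have [iYl _ _ _ _] := hiY.
have Yc : Y (comb X n y a) by apply: subspace_sum => // i _.
rewrite addrC -scaleN1r iYl// -hz mulN1r.
rewrite /comb (dual_rep_sumr sY hiY)// (dual_rep_sum hi2)//.
apply/eqP; rewrite addrC subr_eq0; apply/eqP; apply: eq_bigr => i _.
have [fi|nfi] := boolP (fixd i); first by rewrite (hy0 i fi).2 yf.
by rewrite (indSb a i Sa nfi) !mul0r.
Qed.

(** * The implications *)

Lemma closed_subspaceW (X : normedModType RR) (Y : set X) :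
  closed_subspace X Y -> subspace X Y.
Proof. by move=> [_]. Qed.

(** Compactness of the segment gives a cluster point, and an ultrafilter converges to its cluster
    points. *)
Lemma ultra_bounded_cvg (T : Type) (UF : set_system T) (v : T -> RR) (M : RR) :
  UltraFilter UF -> (\forall q \near UF, `|v q| <= M) -> exists l : RR, v @ UF --> l.
Proof.
move=> UFu vM; have UFF : ProperFilter UF by exact: ultra_proper.
have [|l [_ cl]] := @segment_compact RR (- M) M (v @ UF) _.
  by apply: filterS vM => q /=; rewrite in_itv /= ler_norml.
exists l => A Al; have [//|nA] := in_ultra_setVsetC (v @^-1` A) UFu.
by have [x [nAx Ax]] := cl (~` A) A nA Al.
Qed.

Section RealLimits.
Context {T : Type} {F : set_system T} {FF : ProperFilter F}.

Lemma cvg_scale_add (f g : T -> RR) (a b c : RR) : f @ F --> a -> g @ F --> b ->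
  (fun x => c * f x + g x) @ F --> c * a + b.
Proof.
move=> fa gb.
have cfa : (fun x => c * f x) @ F --> c * a by exact: (cvgM (cvg_cst c) fa).
exact: (@cvgD RR RR^o _ F _ (fun x => c * f x) g _ _ cfa gb).
Qed.

Lemma cvg_absB (f g : T -> RR) (a b : RR) : f @ F --> a -> g @ F --> b ->
  (fun x => `|f x - g x|) @ F --> `|a - b|.
Proof.
move=> fa gb.
have fgab : (fun x => f x - g x) @ F --> a - b.
  exact: (@cvgB RR RR^o _ F _ f g _ _ fa gb).
exact: (@cvg_norm RR RR^o _ F _ (fun x => f x - g x) _ fgab).
Qed.

Lemma cvg_sum_scale n (f : 'I_n -> T -> RR) (c a : 'I_n -> RR) :
  (forall k, f k @ F --> a k) -> (fun x => \sum_k c k * f k x) @ F --> \sum_k c k * a k.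
Proof.
move=> h; apply: (@cvg_big RR^o) => [|k _]; first exact: (@add_continuous RR^o).
exact: (cvgM (cvg_cst (c k)) (h k)).
Qed.

End RealLimits.

Section Implications.
Context {C : cat_sig} {X : completeNormedModType RR} {Y : set X} {lam : RR}.
Hypotheses (sY : subspace X Y) (lam0 : 0 <= lam).

Section Bidual.
Context {W : completeNormedModType RR} {iY : W -> X -> RR} (hiY : dual_rep_on X W Y iY).
Context {U : completeNormedModType RR} {i2 : U -> W -> RR} (hi2 : dual_rep_on W U setT i2).

(** A dual representation only asserts that representing elements exist, so [j] is obtained by
    choice. Its values off [Y] are arbitrary. *)
Lemma canonical_embedding_bmorph :
  exists f : X -> U, [/\ bmorph C X U Y setT f, lipnorm X U Y f <= 1
    & forall y, Y y -> forall w, i2 (f y) w = iY w y].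
Proof.
have [_ _ iYl _ _] := hiY.
have /choice[f hf] (y : X) : exists u, Y y -> forall w, i2 u w = iY w y.
  have [Yy|nYy] := pselect (Y y); last by exists 0.
  have [|w w'|u hu] := dual_rep_exists hi2 (iY ^~ y) `|y|.
  - by move=> a w w' _ _; exact: iYl.
  - by rewrite -(dual_repB hiY)// mulrC; exact: (dual_rep_bound sY hiY).
  by exists u => _ w; rewrite hu.
have f1 x y : Y x -> Y y -> `|f x - f y| <= 1 * `|x - y|.
  move=> Yx Yy; rewrite mul1r; apply: (dual_rep_lipschitz (subspaceT W) hi2) => // w _.
  rewrite !hf// -[X in X <= _](_ : `|iY w (x - y)| = _); last first.
    have [iYx _ _ _ _] := hiY; congr `|_|.
    by have := iYx w (-1) y x Yy Yx; rewrite scaleN1r mulN1r [- y + x]addrC => ->; rewrite addrC.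
  rewrite mulrC; apply: (dual_rep_bound sY hiY).
  by rewrite -[x]scale1r addrC -scaleN1r; apply sY => //; rewrite scale1r.
exists f; split=> //; last exact: lipnorm_le.
split=> //; first by exists 1.
move=> i v Yv; apply: (dual_rep_inj (subspaceT W) hi2) => w _.
rewrite hf; last exact: subspace_sum.
rewrite (dual_rep_sum hi2)// (dual_rep_sumr sY hiY)//; apply: eq_bigr => k _.
by rewrite /= hf.
Qed.

Lemma extension_to_local (hnice : nice C) (hban : banach_in C) (h : X -> U) :
  bmorph C X U setT setT h -> lipnorm X U setT h <= lam ->
  (forall y, Y y -> forall w, i2 (h y) w = iY w y) ->
  forall eps : RR, 0 < eps -> forall G : set X, finite_set G ->
  exists V : set X, [/\ G `<=` V, is_subobj C X (bdist X) (bops C X) V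
    & exists phi : X -> X, [/\ bmorph C X X V Y phi,
        lipnorm X X V phi <= lam * (1 + eps)
      & forall e, V e -> Y e -> phi e = e]].
Proof.
move=> [_ [Lh hL] hop] hlam hj eps eps0 G /finite_seqP[s ->].
have [D [T [cD sD [TY Tl] TN Tj]]] :=
  local_reflexivity X Y sY W iY hiY U i2 hi2 (map h s) eps eps0.
exists (h @^-1` D); split.
- by move=> x /= xs; apply: sD; exact: map_f.
- apply: (hnice X _ _ U (bdist U) (bops C U)); [exact: hban | exact: hban | |].
    split; first by exists Lh => x y; exact: hL.
    by move=> i v; exact: hop.
  exact: closed_subspace_subobj.
have hle x y : `|h x - h y| <= lam * `|x - y|.
  apply: le_trans (lipnorm_bound X U setT h _ x y I I) _; first by exists Lh.
  by rewrite ler_wpM2r.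
have TB u v : D u -> D v -> T u - T v = T (u - v).
  by move=> Du Dv; have := Tl (-1) v u Dv Du; rewrite !scaleN1r [- v + u]addrC => ->; rewrite addrC.
have sDsub : subspace U D by exact: closed_subspaceW.
have ThL x y : D (h x) -> D (h y) -> `|T (h x) - T (h y)| <= lam * (1 + eps) * `|x - y|.
  move=> Dx Dy; rewrite TB//; apply: le_trans (TN _ _) _.
    by rewrite addrC -scaleN1r; apply sDsub.
  rewrite mulrAC [leRHS]mulrC ler_pM2l; last lra.
  exact: hle.
exists (T \o h); split.
- split; first by move=> x Dx; exact: TY.
    by exists (lam * (1 + eps)).
  move=> i v Dv; rewrite /= hop//.
  by rewrite (linear_on_sum _ _ D)// => k _; exact: Dv.
- apply: lipnorm_le => //; first by rewrite mulr_ge0//; lra.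
by move=> e De Ye; apply: Tj => // w; exact: hj.
Qed.

End Bidual.

Lemma local_to_extension :
  (forall eps : RR, 0 < eps -> forall G : set X, finite_set G ->
   exists V : set X, [/\ G `<=` V, is_subobj C X (bdist X) (bops C X) V
    & exists phi : X -> X, [/\ bmorph C X X V Y phi,
        lipnorm X X V phi <= lam * (1 + eps)
      & forall e, V e -> Y e -> `|phi e - e| < eps]]) ->
  forall (Z E : normedModType RR) (iota : E -> Z -> RR), dual_rep_on Z E setT iota ->
  forall f : X -> E, bmorph C X E Y setT f ->
  exists h : X -> E, [/\ bmorph C X E setT setT h, forall y, Y y -> h y = f y
    & lipnorm X E setT h <= lam * lipnorm X E Y f].
Proof.
move=> loc Z E iota hi f fm; have [_ fL fop] := fm; have [Y0 _] := sY.
have [il _ ie _ _] := hi.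
have sT := subspaceT Z.
pose Lf := lipnorm X E Y f.
have Lf0 : 0 <= Lf by exact: lipnorm_ge0.
have fle : forall x y, Y x -> Y y -> `|f x - f y| <= Lf * `|x - y|.
  exact: lipnorm_bound.
pose ok (q : set X * RR) := finite_set q.1 /\ 0 < q.2.
have /choice[phi hphi] (q : set X * RR) : exists phi : X -> X, ok q ->
    exists V : set X, [/\ q.1 `<=` V, closed_under C X (bops C X) V, bmorph C X X V Y phi,
      forall x y, V x -> V y -> `|phi x - phi y| <= lam * (1 + q.2) * `|x - y|
    & forall e, V e -> Y e -> `|phi e - e| < q.2].
  have [[q1 q2]|nq] := pselect (ok q); last by exists id.
  have [V [GV [cl _] [phi [pm pl pe]]]] := loc q.2 q2 q.1 q1.
  exists phi => _; exists V; split=> // x y Vx Vy.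
  have [_ pL _] := pm.
  by apply: le_trans (lipnorm_bound X X V phi pL x y Vx Vy) _; rewrite ler_wpM2r.
(* The filter of tails: [G] grows and [eps] shrinks. *)
pose F : set_system (set X * RR) :=
  filter_from ok (fun p => [set q | [/\ ok q, p.1 `<=` q.1 & q.2 <= p.2]]).
have FF : ProperFilter F.
  apply: filter_from_proper; last by move=> q okq; exists q; split.
  apply: filter_from_filter; first by exists (set0, 1); split; [exact: finite_set0 | exact: ltr01].
  move=> [G e] [G' e'] [/= fG e0] [/= fG' e'0]; exists (G `|` G', Num.min e e').
    by split; rewrite /= ?finite_setU// lt_min e0.
  move=> [G'' e''] [/= okq sub le]; move: le; rewrite le_min => /andP[le1 le2].
  by split; split=> //= x Gx; apply: sub; [left | right].
have [UF [UFu FU]] := ultraFilterLemma FF.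
have near_base (G : set X) (e : RR) : finite_set G -> 0 < e -> UF [set q | [/\ ok q, G `<=` q.1 & q.2 <= e]].
  by move=> fG e0; apply: FU; exists (G, e).
have UFF : ProperFilter UF by exact: ultra_proper.
have eventually (G : set X) (e : RR) (P : set X * RR -> Prop) : finite_set G -> 0 < e ->
   (forall q V, [/\ ok q, G `<=` V & q.2 <= e] ->
     [/\ closed_under C X (bops C X) V, bmorph C X X V Y (phi q),
      forall x y, V x -> V y -> `|phi q x - phi q y| <= lam * (1 + q.2) * `|x - y|
    & forall e, V e -> Y e -> `|phi q e - e| < q.2] -> P q) -> \forall q \near UF, P q.
  move=> fG e0 h; apply: filterS (near_base G e fG e0) => q [okq Gq qe].
  have [V [qV clV pm pL pe]] := hphi q okq.
  by apply: (h q V); split=> //; exact: subset_trans qV.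
pose val (x : X) (z : Z) (q : set X * RR) : RR := iota (f (phi q x)) z.
(* Once [eps] is at most 1, [phi] moves 0 by less than 1 and has Lipschitz constant at most
   [2 * lam]. Hence 0 is put into [G] below. *)
pose bnd (x : X) : RR := `|f 0| + Lf * (1 + lam * 2 * `|x|).
have bounded x z : \forall q \near UF, `|val x z q| <= bnd x * `|z|.
  apply: (eventually [set x; 0] 1); [exact: finite_set2 | exact: ltr01 |].
  move=> q V [[_ q0] GV q1] [_ [pY _ _] pL pe].
  have Vx : V x by apply: GV; left.
  have V0 : V 0 by apply: GV; right.
  apply: le_trans (dual_rep_bound sT hi _ _ I) _; rewrite ler_wpM2r//.
  have e1 := fle _ _ (pY x Vx) Y0.
  have e2 : `|phi q x| <= 1 + lam * 2 * `|x|.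
    have := pL x 0 Vx V0; have := pe 0 V0 Y0; rewrite !subr0 => e3 e4.
    have := ler_distD (phi q 0) (phi q x) 0; rewrite !subr0 => e5.
    have : lam * (1 + q.2) * `|x| <= lam * 2 * `|x|.
      by rewrite ler_wpM2r// ler_wpM2l//; lra.
    lra.
  have := ler_distD (f 0) (f (phi q x)) 0; rewrite !subr0.
  have : Lf * `|phi q x - 0| <= Lf * (1 + lam * 2 * `|x|) by rewrite subr0 ler_wpM2l.
  rewrite /bnd; lra.
have /choice[H hH] xz : exists l : RR, val xz.1 xz.2 @ UF --> l.
  exact: ultra_bounded_cvg (bounded xz.1 xz.2).
have Hcvg x z : val x z @ UF --> H (x, z) by exact: (hH (x, z)).
have uniq (v : set X * RR -> RR) (a b : RR) : v @ UF --> a -> v @ UF --> b -> a = b.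
  by move=> va vb; exact: (@cvg_unique _ (@Rhausdorff RR) (v @ UF) _ a b va vb).
have Hlin x : lin_on Z setT (fun z => H (x, z)).
  move=> a z1 z2 _ _; apply: (uniq _ _ _ (Hcvg x (a *: z1 + z2))).
  have -> : val x (a *: z1 + z2) = (fun q => a * val x z1 q + val x z2 q).
    by apply/funext => q; rewrite /val il.
  exact: cvg_scale_add.
have Hbnd x z : `|H (x, z)| <= bnd x * `|z|.
  apply: (cvgr_to_le _ (bounded x z)).
  exact: (@cvg_norm RR RR^o _ UF _ (val x z) _ (Hcvg x z)).
have HB x z z' : H (x, z) - H (x, z') = H (x, z - z').
  have := Hlin x (-1) z' z I I.
  by rewrite scaleN1r mulN1r [- z' + z]addrC => ->; rewrite addrC.
have /choice[h hh] (x : X) : exists e, forall z, iota e z = H (x, z).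
  have [|z z'|e he] := dual_rep_exists hi (fun z => H (x, z)) (bnd x).
  - exact: Hlin.
  - by rewrite HB.
  by exists e => z; exact: he.
have hlip x y : `|h x - h y| <= lam * Lf * `|x - y|.
  apply: (dual_rep_lipschitz sT hi); first by rewrite !mulr_ge0.
  move=> z _; rewrite !hh.
  apply/ler_addgt0Pr => e e0.
  pose K := lam * Lf * `|x - y| * `|z|.
  have K0 : 0 <= K by rewrite !mulr_ge0.
  (* The excess over [K] is [e' * K], at most [e]; the added 1 keeps the denominator positive. *)
  pose e' := e / (K + 1).
  have e'0 : 0 < e' by rewrite divr_gt0// ltr_wpDl.
  apply: (cvgr_to_le (cvg_absB _ _ _ _ (Hcvg x z) (Hcvg y z))).
  apply: (eventually [set x; y] e'); [exact: finite_set2 | by [] |].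
  move=> q V [_ GV qe] [_ [pY _ _] pL _].
  have Vx : V x by apply: GV; left.
  have Vy : V y by apply: GV; right.
  rewrite /val -(dual_repB hi)//; apply: le_trans (dual_rep_bound sT hi _ _ I) _.
  apply: (@le_trans _ _ (Lf * (lam * (1 + e') * `|x - y|) * `|z|)).
    rewrite ler_wpM2r//; apply: le_trans (fle _ _ (pY _ Vx) (pY _ Vy)) _.
    rewrite ler_wpM2l//; apply: le_trans (pL _ _ Vx Vy) _.
    by rewrite ler_wpM2r// ler_wpM2l// lerD2l.
  have -> : Lf * (lam * (1 + e') * `|x - y|) * `|z| = K + e' * K by rewrite /K; ring.
  rewrite lerD2l /e' mulrAC ler_pdivrMr; last by rewrite ltr_wpDl.
  by rewrite ler_pM2l// lerDl.
exists h; split; [split=> // | | ].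
- by exists (lam * Lf).
- move=> i v _; apply: (dual_rep_inj sT hi) => z _; rewrite hh.
  rewrite (dual_rep_sum hi)//.
  have lim2 : (fun q => \sum_k ccoef C i k * val (v k) z q) @ UF -->
      \sum_k ccoef C i k * H (v k, z).
    by apply: cvg_sum_scale.
  under eq_bigr do rewrite /= hh.
  apply: (uniq _ _ _ (Hcvg _ z)); apply: cvg_trans lim2; apply: near_eq_cvg.
  (* Once [V] contains all [v k], [phi] and then [f] commute with the operation, so the two families
     agree before the limit is taken. *)
  apply: (eventually (range v `|` [set 0]) 1); [|exact: ltr01|].
    by rewrite finite_setU; split; [exact: finite_image | exact: finite_set1].
  move=> q V [_ GV _] [_ [pY _ pop] _ _].
  have Vv k : V (v k) by apply: GV; left; exists k.
  rewrite /val pop// fop => [|k]; last exact: pY.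
  by rewrite (dual_rep_sum hi).
- move=> y Yy; apply: (dual_rep_inj sT hi) => z _; rewrite hh.
  apply: (uniq _ _ _ (Hcvg y z)); apply/(@cvgrPdist_le RR RR^o) => e e0.
  (* With tolerance [e / K], the Lipschitz bound of [f] turns the displacement of [y] into an error
     below [e] at [z]. *)
  pose K := Lf * `|z| + 1.
  have K0 : 0 < K by rewrite ltr_wpDl// mulr_ge0.
  apply: (eventually [set y] (e / K)); [exact: finite_set1 | by rewrite divr_gt0 |].
  move=> q V [_ GV qe] [_ [pY _ _] _ pe].
  have Vy : V y by exact: GV.
  rewrite /val -(dual_repB hi)//; apply: le_trans (dual_rep_bound sT hi _ _ I) _.
  apply: (@le_trans _ _ (Lf * (e / K) * `|z|)).
    rewrite ler_wpM2r//; apply: le_trans (fle _ _ Yy (pY _ Vy)) _.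
    rewrite ler_wpM2l// distrC; apply: le_trans qe; apply: ltW; exact: pe.
  rewrite mulrAC mulrA ler_pdivrMr// mulrC ler_pM2l// /K; lra.
- by apply: lipnorm_le => //; rewrite mulr_ge0.
Qed.
End Implications.

Theorem theorem3p1 (C : cat_sig) (hnice : nice C) (hban : banach_in C)
  (X : completeNormedModType RR) (Y : set X) (hY : closed_subspace X Y)
  (lam : RR) (hlam : 1 <= lam)
  (* W is Y^* (functionals on Y represented as maps X -> R, restricted to Y) *)
  (W : completeNormedModType RR) (iY : W -> X -> RR) (hiY : dual_rep_on X W Y iY)
  (* U is Y^** = W^* *)
  (U : completeNormedModType RR) (i2 : U -> W -> RR) (hi2 : dual_rep_on W U setT i2) :
  [<->
   (* (1) *)
   (forall (Z E : completeNormedModType RR) (iota : E -> Z -> RR),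
      dual_rep_on Z E setT iota ->
      forall f : X -> E, bmorph C X E Y setT f ->
      exists h : X -> E, [/\ bmorph C X E setT setT h,
                             (forall y, Y y -> h y = f y)
                           & lipnorm X E setT h <= lam * lipnorm X E Y f]);
   (* (2) : h|_Y = j, the canonical embedding Y -> Y^** *)
   (exists h : X -> U, [/\ bmorph C X U setT setT h,
                           lipnorm X U setT h <= lam
                         & forall y, Y y -> forall w, i2 (h y) w = iY w y]);
   (* (3) *)
   (forall eps : RR, 0 < eps -> forall G : set X, finite_set G ->
      exists V : set X, [/\ G `<=` V, is_subobj C X (bdist X) (bops C X) V
        & exists phi : X -> X, [/\ bmorph C X X V Y phi,
                                   lipnorm X X V phi <= lam * (1 + eps)
                                 & forall e, V e -> Y e -> phi e = e]]);
   (* (4) *)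
   (forall eps : RR, 0 < eps -> forall G : set X, finite_set G ->
      exists V : set X, [/\ G `<=` V, is_subobj C X (bdist X) (bops C X) V
        & exists phi : X -> X, [/\ bmorph C X X V Y phi,
                                   lipnorm X X V phi <= lam * (1 + eps)
                                 & forall e, V e -> Y e -> `|phi e - e| < eps]])].
Proof.
have sY := closed_subspaceW X Y hY.
have lam0 : 0 <= lam by exact: le_trans hlam.
tfae.
- move=> ext; have [f [fm f1 fj]] := canonical_embedding_bmorph (C := C) sY hiY hi2.
  have [h [hm hf hl]] := ext W U i2 hi2 f fm.
  exists h; split=> // [|y Yy w]; last by rewrite hf// fj.
  by apply: le_trans hl _; rewrite -[leRHS]mulr1 ler_wpM2l.
- move=> [h [hm hl hj]]; exact: (extension_to_local sY lam0 hiY hi2 hnice hban h).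
- move=> loc eps eps0 G fG; have [V [GV oV [phi [pm pl pe]]]] := loc eps eps0 G fG.
  exists V; split=> //; exists phi; split=> // e Ve Ye.
  by rewrite pe// subrr normr0.
- move=> loc Z E iota hi f fm; exact: (local_to_extension sY lam0 loc Z E iota hi f fm).
Qed.
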